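(* Consider the system $\dot{\mathbf{x}}=F(\mathbf{x})\underline{\mathbf{u}}$ with stochastic dynamics ($F$ a random function) and safe set $\mathcal{C}=\{\mathbf{x}\in\mathcal{X}: h(\mathbf{x})\ge0\}$. Suppose the system has relative degree $r\ge1$ with respect to $h$, and that at the triggering time $t_k$, with state $\mathbf{x}_k=\mathbf{x}(t_k)$, the second-order cone program $$\min_{y\in\mathbb{R},\,\mathbf{u}_k\in\mathcal{U}}\ y\quad\text{s.t.}\quad y-\|\mathbf{R}(\mathbf{x}_k)\mathbf{u}_k\|_2\ge0,\qquad \mathbf{e}^{(r)}_k(\mathbf{x}_k)^\top\underline{\mathbf{u}}_k-\zeta-\sqrt{\tfrac{\tilde p_k}{1-\tilde p_k}}\,\big\|\mathbf{V}^{(r)}_k(\mathbf{x}_k)\underline{\mathbf{u}}_k\big\|_2\ge0$$ has a solution when $\zeta=0$ and $\mathbf{e}^{(r)}_k,\mathbf{V}^{(r)}_k$ are formed with $h_b(\mathbf{x})=h(\mathbf{x})-\zeta_b$, $\zeta_b>0$, in place of $h$ as the control barrier function. Suppose that with probability at least $1-\delta_L$ the system dynamics $\mathbf{x}\mapsto F(\mathbf{x})\underline{\mathbf{u}}_k$ are Lipschitz continuous with Lipschitz constant $L_{\mathbf{f}_k}$, and that $h$ is Lipschitz continuous with Lipschitz constant $L_{h_k}$. Then, applying the SOCP solution $\mathbf{u}_k$ as a constant control on $[t_k,t_k+\tau_k)$, it holds with probability $p_k=\tilde p_k(1-\delta_L)$ that $$h(\mathbf{x}(t))\ge0\quad\text{for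 } t\in[t_k,t_k+\tau_k),$$ where $$\tau_k\le\frac{1}{L_{\mathbf{f}_k}}\ln\left(1+\frac{L_{\mathbf{f}_k}\zeta_b}{L_{h_k}\|\dot{\mathbf{x}}_k\|}\right).$$
   Context: $F(\mathbf{x})=[f(\mathbf{x})\ g(\mathbf{x})]\in\mathbb{R}^{n\times(1+m)}$, $\underline{\mathbf{u}}=[1,\mathbf{u}^\top]^\top$, $\mathcal{U}\subset\mathbb{R}^m$ convex, $\mathbf{R}(\mathbf{x})\in\mathbb{R}^{m\times m}$, $\tilde p_k\in(0,1)$, $\delta_L\in(0,1)$, and $\dot{\mathbf{x}}_k=\dot{\mathbf{x}}(t_k)$. $\mathcal{L}_f,\mathcal{L}_g$ denote Lie derivatives. The relative degree with respect to $h\in C^r(\mathcal{X},\mathbb{R})$ is $r$ if $\mathcal{L}_g\mathcal{L}_f^{(r-1)}h(\mathbf{x})\ne0$ and $\mathcal{L}_g\mathcal{L}_f^{(j-1)}h(\mathbf{x})=0$ for $j\in\{1,\dots,r-1\}$. For a function $h$, set $\boldsymbol{\eta}(\mathbf{x})=[h(\mathbf{x}),\mathcal{L}_fh(\mathbf{x}),\dots,\mathcal{L}_f^{(r-1)}h(\mathbf{x})]^\top$, let $\mathbf{k}_\alpha\in\mathbb{R}^r$ be an exponential control barrier function gain vector, and define $$\mathbf{e}^{(r)}(\mathbf{x})=\mathbb{E}\Big[F(\mathbf{x})^\top\nabla_{\mathbf{x}}\mathcal{L}_f^{(r-1)}h(\mathbf{x})+\begin{bmatrix}\mathbf{k}_\alpha^\top\boldsymbol{\eta}(\mathbf{x})\\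 \mathbf{0}_m\end{bmatrix}\Big],\qquad \mathbf{V}^{(r)}(\mathbf{x})=\mathrm{Var}\Big[F(\mathbf{x})^\top\nabla_{\mathbf{x}}\mathcal{L}_f^{(r-1)}h(\mathbf{x})+\begin{bmatrix}\mathbf{k}_\alpha^\top\boldsymbol{\eta}(\mathbf{x})\\ \mathbf{0}_m\end{bmatrix}\Big]^{1/2}$$ (symmetric positive semidefinite square root); subscript $k$ means moments under the distribution of $F$ available at time $t_k$. An exponential control barrier function is an $h\in C^r(\mathcal{X},\mathbb{R})$ for which there is $\mathbf{k}_\alpha\in\mathbb{R}^r$ such that, with $\mathrm{CBC}^{(r)}(\mathbf{x},\mathbf{u})=\mathcal{L}_f^{(r)}h(\mathbf{x})+\mathcal{L}_g\mathcal{L}_f^{(r-1)}h(\mathbf{x})\mathbf{u}+\mathbf{k}_\alpha^\top\boldsymbol{\eta}(\mathbf{x})$, one has $\sup_{\mathbf{u}\in\mathcal{U}}\mathrm{CBC}^{(r)}(\mathbf{x},\mathbf{u})\ge0$ for all $\mathbf{x}\in\mathcal{X}$ and $h(\mathbf{x}(t))\ge\mathbf{c}^\top e^{(\mathcal{F}-\mathcal{G}\mathbf{k}_\alpha^\top)t}\boldsymbol{\eta}(\mathbf{x}(0))\ge0$ whenever $h(\mathbf{x}(0))\ge0$; here $\mathbf{c}=[1,0,\dots,0]^\top$, $\mathcal{F}$ is the $r\times r$ matrix with ones on the superdiagonal and zeros elsewhere, and $\mathcal{G}=[0,\dots,0,1]^\top$.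
   Formalization: The formal theorem additionally assumes h_b(x_k) ≥ 0, i.e. h(x_k) ≥ ζ_b at the triggering time; without it the claim fails, even when h(x_k) ≥ 0 and the cone program is solvable. *)

(* Defs.v *)
From HB Require Import structures.
From mathcomp Require Import all_boot all_order all_algebra.
From mathcomp Require Import all_classical all_reals all_analysis.

Set Implicit Arguments.
Unset Strict Implicit.
Unset Printing Implicit Defensive.
Import Order.TTheory GRing.Theory Num.Theory.
Import numFieldNormedType.Exports.
Local Open Scope classical_set_scope.
Local Open Scope ring_scope.

(* Points of R^n are column vectors.  The norm `|x| of the library on 'cV[R]_n
   is the sup norm; all norms of the development are Euclidean, hence [enorm]. *)
Definition enorm (R : realType) (n : nat) (v : 'cV[R]_n) : R :=
  Num.sqrt (\sum_(i < n) v i 0 ^+ 2).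

Definition elipschitz (R : realType) (n p : nat) (L : R) (X : set 'cV[R]_n)
    (f : 'cV[R]_n -> 'cV[R]_p) : Prop :=
  forall x y, X x -> X y -> enorm (f x - f y) <= L * enorm (x - y).

(* The "at least p" reading of "with probability p"; the inner event [E] avoids
   requiring that [Q] itself be measurable. *)
Definition with_prob (d : measure_display) (T : measurableType d) (R : realType)
    (P : probability T R) (p : R) (Q : T -> Prop) : Prop :=
  exists E : set T, [/\ measurable E, (p%:E <= P E)%E & forall w, E w -> Q w].

Section LieDerivatives.
Variables (R : realType) (n m : nat).
Implicit Types (F : 'cV[R]_n -> 'M[R]_(n, 1 + m)) (phi h : 'cV[R]_n -> R).

Definition basis_vec (i : 'I_n) : 'cV[R]_n := delta_mx i 0.

Definition grad phi (x : 'cV[R]_n) : 'cV[R]_n :=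
  \col_i 'D_(basis_vec i) phi x.

(* C^k on X (meant for X open): all iterated partial derivatives of order at
   most k exist and are continuous at every point of X. *)
Fixpoint class_C (k : nat) (X : set 'cV[R]_n) phi : Prop :=
  (forall x, X x -> {for x, continuous phi}) /\
  if k is k'.+1 then
    forall i : 'I_n, (forall x, X x -> derivable phi x (basis_vec i)) /\
                     class_C k' X ('D_(basis_vec i) phi)
  else True.

(* F x = [f x  g x] *)
Definition drift F (x : 'cV[R]_n) : 'cV[R]_n := lsubmx (F x).
Definition actuation F (x : 'cV[R]_n) : 'M[R]_(n, m) := rsubmx (F x).

Definition lie_f F phi : 'cV[R]_n -> R :=
  fun x => ((grad phi x)^T *m drift F x) 0 0.
Definition lie_g F phi : 'cV[R]_n -> 'rV[R]_m :=
  fun x => (grad phi x)^T *m actuation F x.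
Definition lie_iter F (j : nat) h : 'cV[R]_n -> R := iter j (lie_f F) h.

Definition relative_degree F (X : set 'cV[R]_n) h (r : nat) : Prop :=
  class_C r X h /\
  forall x, X x ->
    lie_g F (lie_iter F r.-1 h) x != 0 /\
    forall j, (1 <= j <= r.-1)%N -> lie_g F (lie_iter F j.-1 h) x = 0.

(* [1; u] *)
Definition ext (u : 'cV[R]_m) : 'cV[R]_(1 + m) := col_mx (const_mx 1) u.

(* x solves x' = F(x) [1; u(t)] in the state space X on [a, b): continuity on
   [a, b) with the equation on (a, b), the initial value being given apart. *)
Definition solution F (X : set 'cV[R]_n) (u : R -> 'cV[R]_m)
    (x : R -> 'cV[R]_n) (a b : R) : Prop :=
  [/\ {within `[a, b[, continuous x},
      forall t, a <= t < b -> X (x t) &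
      forall t, a < t < b -> is_derive t 1 x (F (x t) *m ext (u t))].

Section Ecbf.
Variable r : nat.
Implicit Type ka : 'cV[R]_r.

Definition eta F h (x : 'cV[R]_n) : 'cV[R]_r := \col_(i < r) lie_iter F i h x.

Definition cbc F h ka (x : 'cV[R]_n) (u : 'cV[R]_m) : R :=
  lie_iter F r h x + (lie_g F (lie_iter F r.-1 h) x *m u) 0 0
  + (ka^T *m eta F h x) 0 0.

(* The random vector whose mean and covariance enter the cone program. *)
Definition cbc_vec F h ka (x : 'cV[R]_n) : 'cV[R]_(1 + m) :=
  (F x)^T *m grad (lie_iter F r.-1 h) x + col_mx (ka^T *m eta F h x) 0.

Definition expmx (A : 'M[R]_r) : 'M[R]_r :=
  \matrix_(i, j) limn (fun N : nat =>
    \sum_(0 <= k < N) (k`!%:R^-1 *: A ^+ k) i j).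

Definition shift_mx : 'M[R]_r := \matrix_(i, j) (j == i.+1 :> nat)%:R.
Definition first_vec : 'cV[R]_r := \col_i (i == 0 :> nat)%:R.
Definition last_vec : 'cV[R]_r := \col_i (i.+1 == r :> nat)%:R.

Definition exp_bound F h ka (t : R) (x0 : 'cV[R]_n) : R :=
  (first_vec^T *m expmx (t *: (shift_mx - last_vec *m ka^T)) *m eta F h x0) 0 0.

(* h is an exponential control barrier function with gain ka.  The exponential
   lower bound concerns the motions driven by controls that satisfy the barrier
   condition cbc >= 0. *)
Definition ecbf_gain F (X : set 'cV[R]_n) (U : set 'cV[R]_m) h ka : Prop :=
  [/\ class_C r X h,
      forall x, X x -> (0 <= ereal_sup [set (cbc F h ka x u)%:E | u in U])%E &
      forall (b : R) (u : R -> 'cV[R]_m) (x : R -> 'cV[R]_n),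
        solution F X u x 0 b ->
        (forall t, 0 <= t < b -> U (u t) /\ 0 <= cbc F h ka (x t) (u t)) ->
        0 <= h (x 0) ->
        forall t, 0 <= t < b -> 0 <= exp_bound F h ka t (x 0) <= h (x t)].

End Ecbf.
End LieDerivatives.

Section Moments.
Variables (d : measure_display) (T : measurableType d) (R : realType).
Variables (P : probability T R) (q : nat).
Implicit Type Z : T -> 'cV[R]_q.

Definition square_integrable_vec Z : Prop :=
  forall i, (fun w => Z w i ord0) \in Lfun P 2%:E.

Definition mean_vec Z : 'cV[R]_q := \col_i fine ('E_P[fun w => Z w i ord0]%E).

Definition covar_mx Z : 'M[R]_q :=
  \matrix_(i, j) fine (covariance P (fun w => Z w i ord0) (fun w => Z w j ord0)).

(* V is the symmetric positive semidefinite square root of S *)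
Definition psd_sqrt (S V : 'M[R]_q) : Prop :=
  [/\ V^T = V, forall v : 'cV[R]_q, 0 <= (v^T *m V *m v) 0 0 & V *m V = S].

End Moments.

Section Socp.
Variables (R : realType) (m : nat).

Definition socp_feasible (U : set 'cV[R]_m) (Rx : 'M[R]_m) (e : 'cV[R]_(1 + m))
    (V : 'M[R]_(1 + m)) (p zeta : R) (y : R) (u : 'cV[R]_m) : Prop :=
  [/\ U u,
      0 <= y - enorm (Rx *m u) &
      0 <= (e^T *m ext u) 0 0 - zeta
           - Num.sqrt (p / (1 - p)) * enorm (V *m ext u)].

Definition socp_solution (U : set 'cV[R]_m) (Rx : 'M[R]_m) (e : 'cV[R]_(1 + m))
    (V : 'M[R]_(1 + m)) (p zeta : R) (y : R) (u : 'cV[R]_m) : Prop :=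
  socp_feasible U Rx e V p zeta y u /\
  forall y' u', socp_feasible U Rx e V p zeta y' u' -> y <= y'.

End Socp.

(* (1 / Lf) ln (1 + Lf zb / (Lh |v|)), which is +oo for v = 0 (the convention
   x / 0 = 0 of the library would give 0). *)
Definition max_hold (R : realType) (n : nat) (Lf Lh zb : R) (v : 'cV[R]_n) :
    \bar R :=
  if v == 0 then +oo%E
  else (Lf^-1 * ln (1 + Lf * zb / (Lh * enorm v)))%:E.

(* Main.v *)
(* Since h(x_k) >= zb, it suffices that the motion stays within zb / Lh of x_k.
   Along x' = G(x) with G Lipschitz, |x'| <= |G(x_k)| + Lf |x - x_k|, and
   Gronwall's inequality gives
   |x(t) - x_k| <= |G(x_k)| / Lf (e^(Lf (t - t_k)) - 1);
   the bound on tau is exactly the time at which the right-hand side reaches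
   zb / Lh.  All this happens on the event where the dynamics is Lipschitz, whose
   probability is at least 1 - dL >= pt (1 - dL). *)
Require Import Defs.
From mathcomp Require Import all_boot all_order all_algebra.
From mathcomp Require Import all_classical all_reals all_analysis ring lra.
Import Order.TTheory GRing.Theory Num.Theory.
Import numFieldNormedType.Exports.
Local Open Scope classical_set_scope.
Local Open Scope ring_scope.

(** Cutting from the event [E] a null set [N] that contains every failure of the implication keeps
    its measure. This lets almost sure hypotheses be used on an event of probability at least
    [p]. *)
Lemma with_prob_ae (d : measure_display) (T : measurableType d) (R : realType)
    (P : probability T R) (p q : R) (Q Q' : T -> Prop) :
  q <= p -> {ae P, forall w, Q w -> Q' w} ->
  with_prob P p Q -> with_prob P q Q'.
Proof.
move=> qp [N [mN PN QN]] [E [mE pE EQ]]; exists (E `\` N); split.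
- exact: measurableD.
- have -> : P (E `\` N) = P E.
    rewrite measureD//; last first.
      by rewrite (le_lt_trans (probability_le1 _ _)) ?ltry.
    rewrite [X in (_ - X)%E](_ : _ = 0%E) ?sube0//.
    by apply/eqP; rewrite -measure_le0 -PN measureIr.
  by rewrite (le_trans _ pE)// lee_fin.
- move=> w [/EQ Qw Nw]; have [//|nQ'] := pselect (Q' w).
  by exfalso; apply/Nw/QN => /(_ Qw).
Qed.

Section Euclidean.
Context {R : realType} {n : nat}.
Implicit Types u v : 'cV[R]_n.

Lemma enorm_sqr v : enorm v ^+ 2 = \sum_(i < n) v i 0 ^+ 2.
Proof. by rewrite sqr_sqrtr// sumr_ge0// => i _; rewrite sqr_ge0. Qed.

Lemma enorm_ge0 v : 0 <= enorm v. Proof. exact: sqrtr_ge0. Qed.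

Lemma enorm0 : enorm (0 : 'cV[R]_n) = 0.
Proof.
by rewrite /enorm big1 ?sqrtr0// => i _; rewrite mxE expr0n.
Qed.

Lemma enormB u v : enorm (u - v) = enorm (v - u).
Proof.
rewrite /enorm; congr Num.sqrt; apply: eq_bigr => i _.
by rewrite !mxE -sqrrN opprB.
Qed.

Lemma enorm0_eq0 v : enorm v = 0 -> v = 0.
Proof.
move=> v0; apply/colP => i; rewrite mxE; apply/eqP; rewrite -sqrf_eq0.
have /eqP := enorm_sqr v; rewrite v0 expr0n eq_sym psumr_eq0//=; last first.
  by move=> j _; rewrite sqr_ge0.
by move=> /allP/(_ i); rewrite mem_index_enum; exact.
Qed.

Lemma enorm_gt0 v : v != 0 -> 0 < enorm v.
Proof.
by rewrite lt_def enorm_ge0 andbT; apply: contra_neq => /enorm0_eq0.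
Qed.

(** Cauchy-Schwarz: for nonzero vectors with norms [a] and [b], the nonnegative sum of the
    [(b * u i 0 - a * v i 0) ^+ 2] equals [2 * (a * b) * (a * b - s)], and the positive factor
    cancels. *)
Lemma dot_le_enorm u v : \sum_(i < n) u i 0 * v i 0 <= enorm u * enorm v.
Proof.
have [->|u0] := eqVneq u 0.
  rewrite big1 ?mulr_ge0 ?enorm_ge0// => i _.
  by rewrite mxE mul0r.
have [->|v0] := eqVneq v 0.
  rewrite big1 ?mulr_ge0 ?enorm_ge0// => i _.
  by rewrite mxE mulr0.
have : 0 <= \sum_(i < n) (enorm v * u i 0 - enorm u * v i 0) ^+ 2.
  by apply: sumr_ge0 => i _; rewrite sqr_ge0.
set a := enorm u; set b := enorm v; set s := \sum_(i < n) u i 0 * v i 0.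
have -> : \sum_(i < n) (b * u i 0 - a * v i 0) ^+ 2 = 2 * (a * b) * (a * b - s).
  transitivity (b ^+ 2 * (\sum_(i < n) u i 0 ^+ 2) - 2 * (a * b) * s +
                a ^+ 2 * (\sum_(i < n) v i 0 ^+ 2)).
    rewrite !mulr_sumr -sumrB -big_split/=.
    by apply: eq_bigr => i _; ring.
  by rewrite -!enorm_sqr -/a -/b; ring.
have ab0 : 0 < a * b by rewrite mulr_gt0 ?enorm_gt0.
by rewrite pmulr_rge0 ?subr_ge0//; apply: mulr_gt0.
Qed.

End Euclidean.

Lemma is_derive_coord {R : realType} {n : nat} {x : R -> 'cV[R]_n} {t : R}
    {v : 'cV[R]_n} (i : 'I_n) :
  is_derive t 1 x v -> is_derive t 1 (fun s => x s i 0) (v i 0).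
Proof.
move=> [dx <-]; split; first by move/derivable_mxP : dx => /(_ i 0).
by rewrite derive_mx// mxE.
Qed.

(** Integrating factor: shifting [g] by [c / L] makes the inequality homogeneous, so its product [k]
    with [expR (- L * (t - a))] has nonpositive derivative. *)
Lemma gronwall {R : realType} {g dg : R -> R} {a b L c : R} :
  a <= b -> L != 0 -> {within `[a, b], continuous g} ->
  (forall t, a < t < b -> is_derive t 1 g (dg t)) ->
  (forall t, a < t < b -> dg t <= L * g t + c) ->
  g b <= g a * expR (L * (b - a)) + c / L * (expR (L * (b - a)) - 1).
Proof.
move=> ab L0 cg gdg dgle.
pose k t := (g t + c / L) * expR (- L * (t - a)).
have kd t : a < t < b ->
    is_derive t 1 k ((dg t - (L * g t + c)) * expR (- L * (t - a))).
  move=> /gdg gt; rewrite /k.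
  have e : is_derive t 1 (fun s => expR (- L * (s - a)))
      (expR (- L * (t - a)) * - L).
    apply: (@is_derive1_comp _ expR (fun s => - L * (s - a))).
    apply: is_derive_eq.
    by rewrite subr0 [_ *: _]mulr1.
  apply: is_derive_eq. rewrite addr0 -![_ *: _]/(_ * _).
  by field.
have ck : {within `[a, b], continuous k}.
  move=> t; apply: cvgM.
    by apply: cvgD; [exact: cg|exact: cvg_cst].
  apply: continuous_comp; last exact: continuous_expR.
  apply: cvgM; first exact: cvg_cst.
  apply: cvgB; last exact: cvg_cst.
  have idc : continuous (id : R -> R) by move=> ?; exact: cvg_id.
  exact: (continuous_subspaceT idc).
(* The sign of the derivative is known only inside the interval; continuity on the closed interval
   extends monotonicity to the endpoints. *)
have kab : k b <= k a.
  apply: (@ler0_derive1_le_cc _ k a b) => //.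
  - move=> t; rewrite in_itv/= => /kd kt; exact: ex_derive.
  - move=> t; rewrite in_itv/= => tab; have kt := kd _ tab.
    rewrite derive1E derive_val mulr_le0_ge0 ?expR_ge0// subr_le0; exact: dgle.
  - by rewrite in_itv/= lexx ab.
  - by rewrite in_itv/= lexx ab.
move: kab; rewrite /k subrr mulr0 expR0 mulr1 mulNr expRN.
rewrite ler_pdivrMr ?expR_gt0// => kab.
lra.
Qed.

(** Gronwall's inequality is applied to the smoothed distance [g], the square root of the squared
    distance to [x a] plus [del ^+ 2]; then [del] is absorbed by an arbitrary slack [eps]. *)
Lemma enorm_displacement_le {R : realType} {n : nat} {X : set 'cV[R]_n}
    {G : 'cV[R]_n -> 'cV[R]_n} {L : R} {x : R -> 'cV[R]_n} {a b : R} :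
  a <= b -> 0 < L -> elipschitz L X G ->
  {within `[a, b], continuous x} ->
  (forall t, a <= t < b -> X (x t)) ->
  (forall t, a < t < b -> is_derive t 1 x (G (x t))) ->
  enorm (x b - x a) <= enorm (G (x a)) / L * (expR (L * (b - a)) - 1).
Proof.
rewrite le_eqVlt => /predU1P[<- L0 _ _ _ _|].
  by rewrite !subrr mulr0 expR0 subrr mulr0 enorm0.
move=> ab L0 lipG cx Xx dx.
set c := enorm (G (x a)); set e := expR _.
have e0 : 0 < e by exact: expR_gt0.
(* The slack pays for the smoothing: [g] starts at [del] instead of 0, and Gronwall multiplies this
   by [e], hence the choice [eps / e]. *)
apply/ler_addgt0Pr => eps eps0.
(* The summand del ^+ 2 keeps g differentiable where x t = x a. *)
pose del := eps / e; have del0 : 0 < del by rewrite divr_gt0.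
pose S t := \sum_(i < n) (x t i 0 - x a i 0) ^+ 2 + del ^+ 2.
have SE t : S t = enorm (x t - x a) ^+ 2 + del ^+ 2.
  by rewrite enorm_sqr; congr (_ + _); apply: eq_bigr => i _; rewrite !mxE.
have S0 t : 0 < S t by rewrite SE ltr_wpDl ?sqr_ge0 ?exprn_gt0.
pose g t := Num.sqrt (S t).
have le_g t : enorm (x t - x a) <= g t.
  rewrite -[leLHS](ger0_norm (enorm_ge0 _)) -sqrtr_sqr ler_wsqrtr//.
  by rewrite SE lerDl sqr_ge0.
have g0 t : 0 < g t by rewrite sqrtr_gt0.
have ga : g a = del.
  by rewrite /g SE subrr enorm0 expr0n add0r sqrtr_sqr gtr0_norm.
(* Half the derivative of [S], by the chain rule along the motion. *)
pose dot t := \sum_(i < n) (x t - x a) i 0 * G (x t) i 0.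
have gd t : a < t < b -> is_derive t 1 g (dot t / g t).
  move=> /dx xt.
  have Sd : is_derive t 1 S (2 * dot t).
    have -> : S = \sum_(i < n) (fun s => (x s i 0 - x a i 0) ^+ 2) + cst (del ^+ 2).
      by apply/funext => s; rewrite /S fctE /= fct_sumE.
    have xi i := is_derive_coord i xt.
    apply: is_derive_eq; rewrite addr0 /dot mulr_sumr; apply: eq_bigr => i _.
    by rewrite !mxE subr0 -![_ *: _]/(_ * _); ring.
  have := @is_derive1_comp _ Num.sqrt S t _ _ (is_derive1_sqrt (S0 t)) Sd.
  by move=> /is_derive_eq; apply; rewrite -/(g t); field; rewrite gt_eqF.
have dotle t : a < t < b -> dot t / g t <= L * g t + c.
  move=> /andP[ta tb].
  rewrite ler_pdivrMr//.
  set D := enorm (x t - x a).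
  have D0 : 0 <= D := enorm_ge0 _.
  (* Comparing the velocity with its initial value and applying Cauchy-Schwarz to both sums gives
     the bound [(L * D + c) * D]; both occurrences of [D] are then bounded by [g t]. *)
  have -> : dot t = \sum_(i < n) (x t - x a) i 0 * (G (x t) - G (x a)) i 0 +
                    \sum_(i < n) (x t - x a) i 0 * G (x a) i 0.
    by rewrite -big_split/=; apply: eq_bigr => i _; rewrite -mulrDr !mxE subrK.
  have Glip : enorm (G (x t) - G (x a)) <= L * D.
    by apply: lipG; apply: Xx; rewrite ?lexx ?ab ?(ltW ta).
  apply: (@le_trans _ _ (D * (L * D) + D * c)).
    by apply: lerD; apply: (le_trans (dot_le_enorm _ _)); rewrite // ler_wpM2l.
  have -> : D * (L * D) + D * c = (L * D + c) * D by ring.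
  have c0 : 0 <= c := enorm_ge0 _.
  apply: ler_pM; rewrite ?addr_ge0 ?mulr_ge0 ?(ltW L0)// ?lerD2r ?ler_pM2l//;
    exact: le_g.
have cg : {within `[a, b], continuous g}.
  move=> t; apply: continuous_comp; last exact: sqrt_continuous.
  apply: cvgD; last exact: cvg_cst.
  apply: cvg_big => [|i _]; first exact: add_continuous.
  apply: (@continuous_comp _ _ _ (fun s : subspace `[a, b] => x s i 0)
    (fun z => (z - x a i 0) ^+ 2)).
    apply: (@continuous_comp _ _ _ (x : subspace `[a, b] -> _) (fun M => M i 0)).
      exact: cx.
    exact: coord_continuous.
  by apply: cvgM; apply: cvgB; first [exact: cvg_id|exact: cvg_cst].
have := gronwall (ltW ab) (lt0r_neq0 L0) cg gd dotle.
rewrite ga -/e divfK ?gt_eqF// addrC => gb.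
exact: le_trans (le_g b) gb.
Qed.

(** Exponentiating the bound on [s] gives [expR (L * s) - 1 <= L * z / (Lh * enorm v)], and the
    prefactor turns the right-hand side into [z]. For [v = 0] the growth vanishes, which matches the
    value [+oo]. *)
Lemma max_hold_growth (R : realType) (n : nat) (L Lh z s : R) (v : 'cV[R]_n) :
  0 < L -> 0 < Lh -> 0 < z -> (s%:E <= max_hold L Lh z v)%E ->
  Lh * (enorm v / L * (expR (L * s) - 1)) <= z.
Proof.
move=> L0 Lh0 z0; rewrite /max_hold; case: eqVneq => [->|v0].
  by move=> _; rewrite enorm0 !mul0r mulr0 ltW.
have ev0 := enorm_gt0 v v0.
have q0 : 0 < L * z / (Lh * enorm v) by rewrite divr_gt0 ?mulr_gt0.
rewrite lee_fin ler_pdivlMl// => es.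
rewrite -ler_expR lnK ?posrE ?addr_gt0// in es.
have -> : z = Lh * (enorm v / L * (L * z / (Lh * enorm v))).
  by field; rewrite !gt_eqF.
by rewrite ler_pM2l// ler_pM2l ?divr_gt0// lerBlDl.
Qed.

Theorem proposition7
  (R : realType) (n m r : nat) (r_ge1 : (1 <= r)%N)
  (d : measure_display) (T : measurableType d) (P : probability T R)
  (X : set 'cV[R]_n) (X_open : open X)
  (U : set 'cV[R]_m) (U_convex : convex_set U)
  (F : T -> 'cV[R]_n -> 'M[R]_(n, 1 + m))
  (F_meas : forall x i j, X x -> measurable_fun setT (fun w => F w x i j))
  (Rm : 'cV[R]_n -> 'M[R]_m)
  (h : 'cV[R]_n -> R) (zb : R) (zb_gt0 : 0 < zb)
  (rel_deg : {ae P, forall w, relative_degree (F w) X h r})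
  (ka : 'cV[R]_r)
  (hb_ecbf : {ae P, forall w, ecbf_gain (F w) X U (fun x => h x - zb) ka})
  (pt dL : R) (pt01 : 0 < pt < 1) (dL01 : 0 < dL < 1)
  (tk : R) (xk : 'cV[R]_n) (xk_in : X xk) (hb_xk : 0 <= h xk - zb)
  (Z_sqint : square_integrable_vec P
     (fun w => cbc_vec (F w) (fun x => h x - zb) ka xk))
  (V : 'M[R]_(1 + m))
  (V_sqrt : psd_sqrt
     (covar_mx P (fun w => cbc_vec (F w) (fun x => h x - zb) ka xk)) V)
  (y : R) (uk : 'cV[R]_m)
  (uk_sol : socp_solution U (Rm xk)
     (mean_vec P (fun w => cbc_vec (F w) (fun x => h x - zb) ka xk))
     V pt 0 y uk)
  (Lf Lh : R) (Lf_gt0 : 0 < Lf) (Lh_gt0 : 0 < Lh)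
  (F_lip : with_prob P (1 - dL)
     (fun w => elipschitz Lf X (fun x => F w x *m ext uk)))
  (h_lip : forall x x', X x -> X x' -> `|h x - h x'| <= Lh * enorm (x - x'))
  (tau : T -> R)
  (tau_le : {ae P, forall w,
     ((tau w)%:E <= max_hold Lf Lh zb (F w xk *m ext uk))%E})
  (x : T -> R -> 'cV[R]_n)
  (x_init : {ae P, forall w, x w tk = xk})
  (x_sol : {ae P, forall w,
     solution (F w) X (fun=> uk) (x w) tk (tk + tau w)}) :
  with_prob P (pt * (1 - dL))
    (fun w => forall t, tk <= t < tk + tau w -> 0 <= h (x w t)).
Proof.
have [/andP[pt0 pt1] /andP[dL0 dL1]] := (pt01, dL01).
apply: with_prob_ae F_lip; first by rewrite ler_piMl ?subr_ge0 ?(ltW dL1) ?ltW.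
(* The filter is that of almost every [w], so the initial value, the equation and the bound on [tau]
   hold together outside one null set. *)
near=> w => lipF t /andP[tkt tt].
have x0 : x w tk = xk by near: w.
have [cx Xx dx] : solution (F w) X (fun=> uk) (x w) tk (tk + tau w) by near: w.
have tauw : ((tau w)%:E <= max_hold Lf Lh zb (F w xk *m ext uk))%E by near: w.
have Xt : X (x w t) by apply: Xx; rewrite tkt.
have dist : enorm (x w t - x w tk) <=
    enorm (F w (x w tk) *m ext uk) / Lf * (expR (Lf * (t - tk)) - 1).
  (* The estimate is taken on the closed interval from [tk] to [t], which lies inside the half-open
     interval where the motion is continuous because [t < tk + tau w]. *)
  apply: (enorm_displacement_le tkt Lf_gt0 lipF).
  - apply: continuous_subspaceW cx => s /=; rewrite !in_itv/= => /andP[-> st].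
    exact: le_lt_trans tt.
  - by move=> s /andP[tks st]; apply: Xx; rewrite tks (lt_trans st).
  - by move=> s /andP[tks st]; apply: dx; rewrite tks (lt_trans st).
have hold : Lh * (enorm (F w xk *m ext uk) / Lf *
                  (expR (Lf * (t - tk)) - 1)) <= zb.
  apply: max_hold_growth => //; apply: le_trans tauw.
  by rewrite lee_fin lerBlDl ltW.
rewrite x0 in dist.
(* The drop of [h] from [xk] is at most [Lh] times the displacement, hence at most [zb], and [hb_xk]
   says that [h xk] is at least [zb]. *)
have := le_trans (ler_norm _) (h_lip _ _ xk_in Xt).
rewrite -(ler_pM2l Lh_gt0) in dist.
rewrite enormB.
lra.
Unshelve. all: by end_near. Qed.
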